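(* (i) Let $m\in\mathbb{N}=\{0,1,2,\ldots\}$ and $n\in\mathbb{Z}^+$. Then $$2\binom{m+n}{n}\ \Big|\ \binom{2n}{n}\binom{2m+2n}{2n},$$ and the quotient $\binom{2n}{n}\binom{2m+2n}{2n}\big/\big(2\binom{m+n}{n}\big)$ is odd if and only if $n$ is a power of two. Moreover, when $n>1$, $$8\binom{m+n}{n}\ \Big|\ \binom{2n}{n}\binom{2m+2n}{2n-1},$$ and the quotient $\binom{2n}{n}\binom{2m+2n}{2n-1}\big/\big(8\binom{m+n}{n}\big)$ is odd if and only if $n-1$ is a power of two. (ii) Let $k,n\in\mathbb{Z}^+$. Then $$2\binom{kn}{n}\ \Big|\ \binom{2n}{n}C_{2n}^{(k-1)},$$ and the quotient $\binom{2n}{n}C_{2n}^{(k-1)}\big/\big(2\binom{kn}{n}\big)$ is odd if and only if $n$ is a power of two.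
   Context: For $h,m\in\mathbb{N}$, the generalized Catalan number of order $h$ is $C_m^{(h)}=\frac{1}{hm+1}\binom{(h+1)m}{m}=\binom{(h+1)m}{m}-h\binom{(h+1)m}{m-1}$, an integer. ''Power of two'' means $2^a$ for some $a\in\mathbb{N}$ (so $1$ counts). *)

(* Defs.v *)
From mathcomp Require Import all_boot.

Set Implicit Arguments.
Unset Strict Implicit.
Unset Printing Implicit Defensive.

(* The division is exact: see gen_catalanM. *)
Definition gen_catalan (h m : nat) : nat := 'C(h.+1 * m, m) %/ (h * m).+1.

Definition power_of_two (n : nat) : Prop := exists a : nat, n = 2 ^ a.

Lemma gen_catalan_sub_mul (h m : nat) :
  (h * m.+1).+1 * ('C(h.+1 * m.+1, m.+1) - h * 'C(h.+1 * m.+1, m)) =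
  'C(h.+1 * m.+1, m.+1).
Proof.
have := mul_bin_left (h.+1 * m.+1) m.
have -> : h.+1 * m.+1 - m = (h * m.+1).+1 by rewrite mulSn addSn -addnS addKn.
set B := 'C(_, m.+1); set D := 'C(_, m) => e.
by rewrite mulnBr mulnCA -e mulnA mulSn addnK.
Qed.

Lemma gen_catalan_dvd (h m : nat) : (h * m).+1 %| 'C(h.+1 * m, m).
Proof.
case: m => [|m]; first by rewrite !muln0.
by rewrite -[X in _ %| X]gen_catalan_sub_mul dvdn_mulr.
Qed.

Lemma gen_catalanM (h m : nat) :
  gen_catalan h m * (h * m).+1 = 'C(h.+1 * m, m).
Proof. exact: divnK (gen_catalan_dvd h m). Qed.

Lemma gen_catalanS (h m : nat) :
  gen_catalan h m.+1 = 'C(h.+1 * m.+1, m.+1) - h * 'C(h.+1 * m.+1, m).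
Proof. by rewrite /gen_catalan -[X in X %/ _]gen_catalan_sub_mul mulKn. Qed.

(* Main.v *)
(** Put [binq n m = 'C(2n, n) 'C(2m+2n, 2n) / 'C(m+n, n)], which is the coefficient
    of [x^n] in [(1 - 4x)^(-m-1/2)].  Comparing the series for [m] and [m+1] gives
    [binq (n+1) (m+1) = binq (n+1) m + 4 binq n (m+1)], so [binq] is an integer congruent to
    [binq n 0 = 'C(2n, n)] modulo 4, and the 2-adic valuation of ['C(2n, n)] is the
    number of binary digits 1 of [n].  Differentiating the series gives
    [(n+1) binq (n+1) m = 2 (2m+1) binq n (m+1)], which reduces the second half of (i) to
    the first; and if [n] divides [m] then [2m+1] is coprime to [n], hence divides
    [binq n m], which gives (ii). *)
Require Import Defs.
From mathcomp Require Import all_boot.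
From mathcomp Require Import zify ring.

Lemma logn2_fact_double (n : nat) : logn 2 (2 * n)`! = n + logn 2 n`!.
Proof.
elim: n => // n IHn.
have -> : 2 * n.+1 = (2 * n).+2 by lia.
rewrite !factS !lognM ?muln_gt0 ?fact_gt0 // IHn.
have -> : logn 2 (2 * n).+1 = 0.
  by apply: logn_coprime; rewrite coprime2n /= oddM.
have -> : logn 2 (2 * n).+2 = (logn 2 n.+1).+1.
  by rewrite (_ : (2 * n).+2 = 2 * n.+1) ?lognM //; lia.
lia.
Qed.

(** Compare valuations in [(2n)! = 'C(2n, n) * n!^2], where [(2n)!] carries exactly [n] more factors
    2 than [n!]. *)
Lemma logn2_central_bin (n : nat) : logn 2 'C(2 * n, n) + logn 2 n`! = n.
Proof.
have := congr1 (logn 2) (@bin_fact (2 * n) n ltac:(lia)).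
have -> : 2 * n - n = n by lia.
rewrite logn2_fact_double !lognM ?muln_gt0 ?fact_gt0 ?bin_gt0; lia.
Qed.

Lemma logn2_central_bin_double (n : nat) :
  logn 2 'C(2 * (2 * n), 2 * n) = logn 2 'C(2 * n, n).
Proof.
have := logn2_central_bin (2 * n); have := logn2_central_bin n.
rewrite logn2_fact_double; lia.
Qed.

Lemma logn2_central_bin_doubleS (n : nat) :
  logn 2 'C(2 * (2 * n).+1, (2 * n).+1) = (logn 2 'C(2 * n, n)).+1.
Proof.
have := logn2_central_bin (2 * n).+1; have := logn2_central_bin n.
rewrite factS lognM ?fact_gt0 // logn2_fact_double.
have -> : logn 2 (2 * n).+1 = 0.
  by apply: logn_coprime; rewrite coprime2n /= oddM.
lia.
Qed.

Lemma central_binS (n : nat) : 'C(2 * n.+1, n.+1) = 2 * 'C((2 * n).+1, n).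
Proof.
have -> : 2 * n.+1 = (2 * n).+2 by lia.
rewrite binS -(@bin_sub (2 * n).+1 n.+1); last by lia.
have -> : (2 * n).+1 - n.+1 = n by lia.
by rewrite addnn -mul2n.
Qed.

Lemma logn2_central_bin_gt0 (n : nat) : 0 < n -> 0 < logn 2 'C(2 * n, n).
Proof.
case: n => // n _; rewrite central_binS lognM ?bin_gt0 //; lia.
Qed.

(** Induction on binary digits: appending a digit 0 keeps the valuation and appending a digit 1
    raises it by one, so an odd [n] qualifies only when [n = 1]. *)
Lemma logn2_central_bin_eq1 (n : nat) :
  logn 2 'C(2 * n, n) = 1 <-> power_of_two n.
Proof.
elim/ltn_ind: n => n IHn.
have [k [En|En]] : exists k, n = 2 * k \/ n = (2 * k).+1.
  by exists n./2; have := odd_double_half n; case: (odd n); lia.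
- case: k En IHn => [|k] -> IHn.
    rewrite muln0 bin0 logn1; split=> [//|[a e]].
    by have := expn_gt0 2 a; rewrite -e.
  rewrite logn2_central_bin_double (IHn k.+1 ltac:(lia)).
  split=> [[a ->]|[[|a]]]; first by exists a.+1; rewrite expnS.
    by rewrite expn0; lia.
  by rewrite expnS => e; exists a; lia.
- case: k En => [|k] ->.
    by rewrite logn2_central_bin_doubleS; split=> // _; exists 0.
  rewrite logn2_central_bin_doubleS; split.
    by have := @logn2_central_bin_gt0 k.+1 isT; lia.
  case=> -[|a]; rewrite ?expn0 ?expnS; lia.
Qed.

Lemma odd_half_central_bin (n : nat) :
  odd 'C((2 * n).+1, n) <-> power_of_two n.+1.
Proof.
rewrite -logn2_central_bin_eq1 central_binS lognM ?bin_gt0; [|lia|lia].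
have c_gt0 : 0 < 'C((2 * n).+1, n) by rewrite bin_gt0; lia.
rewrite (_ : logn 2 2 = 1) // -coprime2n; split=> [/logn_coprime -> //|e].
rewrite prime_coprime //; apply/negP => d2.
by move: e; rewrite [logn 2 'C(_, _)]lognE d2 c_gt0.
Qed.

(** The recurrence in [m] is unrolled into a sum: recursion is then structural in [n], and
    integrality and the residue modulo 4 are visible. *)
Fixpoint binq (n m : nat) : nat :=
  if n is n'.+1 then 'C(2 * n, n) + 4 * \sum_(i < m) binq n' i.+1 else 1.

Lemma binqn0 (n : nat) : binq n 0 = 'C(2 * n, n).
Proof. by case: n => //= n; rewrite big_ord0 muln0 addn0. Qed.

Lemma binqSS (n m : nat) : binq n.+1 m.+1 = binq n.+1 m + 4 * binq n m.+1.
Proof. by rewrite /= big_ord_recr /= mulnDr addnA. Qed.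

Lemma central_bin_rec (n : nat) :
  n.+1 * 'C(2 * n.+1, n.+1) = 2 * (2 * n).+1 * 'C(2 * n, n).
Proof.
have := mul_bin_down (2 * n).+1 n.
rewrite central_binS (_ : (2 * n).+1 - n = n.+1) /=; last by lia.
by move=> e; rewrite mulnCA -e mulnA.
Qed.

Lemma binq_shift (n m : nat) : n.+1 * binq n.+1 m = 2 * (2 * m).+1 * binq n m.+1.
Proof.
elim: n m => [|n IHn]; elim=> [|m IHm].
- by rewrite binqn0.
- by rewrite binqSS /=; move: IHm => /=; lia.
- have := IHn 0; rewrite !binqn0 (central_bin_rec n.+1) binqSS binqn0; lia.
(* By the two induction hypotheses both sides equal [2 * (2m + 2n + 5) * binq n.+1 m.+1]. *)
- rewrite binqSS mulnDr IHm [binq n.+1 m.+2]binqSS.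
  have := IHn m.+1; nia.
Qed.

(** Induction on [n] for all [m]: [binq_shift] trades one unit of [n] for one of [m], which leaves
    [m + n] fixed. The factor [m.+1] is inserted to absorb [(m+1)!]. *)
Lemma binq_fact (n m : nat) :
  binq n m * (n`! * (2 * m)`! * (m + n)`!) = (2 * m + 2 * n)`! * m`!.
Proof.
elim: n m => [|n IHn] m; first by rewrite !muln0 !addn0 fact0 !mul1n.
apply/eqP; rewrite -(eqn_pmul2l (ltn0Sn m)); apply/eqP.
have := IHn m.+1.
have -> : 2 * m.+1 + 2 * n = 2 * m + 2 * n.+1 by lia.
have -> : m.+1 + n = m + n.+1 by lia.
have -> : 2 * m.+1 = (2 * m).+2 by lia.
rewrite (factS m) (factS n) (factS (2 * m).+1) (factS (2 * m)) => e.
transitivity ((2 * m + 2 * n.+1)`! * (m.+1 * m`!)); last by ring.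
rewrite -e; transitivity
  (m.+1 * (n.+1 * binq n.+1 m) * (n`! * (2 * m)`! * (m + n.+1)`!)); first by ring.
rewrite binq_shift; ring.
Qed.

Lemma binq_bin (n m : nat) :
  'C(2 * n, n) * 'C(2 * m + 2 * n, 2 * n) = binq n m * 'C(m + n, n).
Proof.
have e1 := @bin_fact (2 * n) n ltac:(lia).
have e2 := @bin_fact (2 * m + 2 * n) (2 * n) ltac:(lia).
have e3 := @bin_fact (m + n) n ltac:(lia).
rewrite (_ : 2 * n - n = n) in e1; last by lia.
rewrite addnK in e2; rewrite addnK in e3.
have e4 := binq_fact n m; rewrite -e2 -e3 -e1 in e4.
have pos : 0 < n`! * (2 * m)`! * (n`! * m`!).
  by rewrite !muln_gt0 !fact_gt0.
apply/eqP; rewrite -(eqn_pmul2r pos); apply/eqP.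
move: e4; set x := 'C(2 * n, n); set y := 'C(2 * m + _, _).
set z := 'C(m + n, n) => e4.
transitivity (y * (x * (n`! * n`!) * (2 * m)`!) * m`!); first by ring.
rewrite -e4; ring.
Qed.

(** Half of [binq] differs from half of the central binomial coefficient by an even number. *)
Lemma binq_half (n m : nat) :
  exists2 h, binq n.+1 m = 2 * h & odd h <-> power_of_two n.+1.
Proof.
exists ('C((2 * n).+1, n) + 2 * \sum_(i < m) binq n i.+1).
  transitivity ('C(2 * n.+1, n.+1) + 4 * \sum_(i < m) binq n i.+1); first by [].
  by rewrite central_binS mulnDr mulnA.
by rewrite oddD oddM addbF odd_half_central_bin.
Qed.

Lemma dvdn_odd_quotient (d x t : nat) (P : Prop) :
  0 < d -> x = d * t -> (odd t <-> P) -> d %| x /\ (odd (x %/ d) <-> P).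
Proof. by move=> d_gt0 ->; rewrite dvdn_mulr // mulKn. Qed.

(** Lowering the index of the second binomial by one costs the factor [(2n+2)/(2m+1)]; [binq_shift]
    cancels it and leaves a 4. *)
Lemma binq_bin_pred (n m : nat) :
  'C(2 * n.+1, n.+1) * 'C(2 * m + 2 * n.+1, 2 * n.+1 - 1)
  = 4 * binq n m.+1 * 'C(m + n.+1, n.+1).
Proof.
apply/eqP; rewrite -(eqn_pmul2l (ltn0Sn (2 * m))); apply/eqP.
have e := binq_bin n.+1 m.
have := mul_bin_left (2 * m + 2 * n.+1) (2 * n.+1 - 1).
rewrite (_ : (2 * n.+1 - 1).+1 = 2 * n.+1); last by lia.
rewrite (_ : _ - (2 * n.+1 - 1) = (2 * m).+1); last by lia.
move=> e2; rewrite mulnCA -e2 mulnCA e.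
transitivity (2 * (n.+1 * binq n.+1 m) * 'C(m + n.+1, n.+1)); first by ring.
rewrite binq_shift; ring.
Qed.

Lemma dvdn_binq (n j : nat) : (2 * (j * n.+1)).+1 %| binq n.+1 (j * n.+1).
Proof.
have co : coprime (2 * (j * n.+1)).+1 n.+1.
  by rewrite mulnA -addn1 coprime_sym /coprime gcdnMDl gcdn1.
by rewrite -(Gauss_dvdr _ co) binq_shift mulnAC dvdn_mull.
Qed.

Theorem theorem1p1 :
  (forall m n : nat, 0 < n ->
     [/\ 2 * 'C(m + n, n) %| 'C(2 * n, n) * 'C(2 * m + 2 * n, 2 * n),
         odd (('C(2 * n, n) * 'C(2 * m + 2 * n, 2 * n)) %/ (2 * 'C(m + n, n)))
           <-> power_of_two n
       & 1 < n ->
         8 * 'C(m + n, n) %| 'C(2 * n, n) * 'C(2 * m + 2 * n, 2 * n - 1) /\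
         (odd (('C(2 * n, n) * 'C(2 * m + 2 * n, 2 * n - 1))
                 %/ (8 * 'C(m + n, n)))
           <-> power_of_two (n - 1))])
  /\
  (forall k n : nat, 0 < k -> 0 < n ->
     2 * 'C(k * n, n) %| 'C(2 * n, n) * gen_catalan (k - 1) (2 * n) /\
     (odd (('C(2 * n, n) * gen_catalan (k - 1) (2 * n)) %/ (2 * 'C(k * n, n)))
       <-> power_of_two n)).

Proof.
split=> [m [//|n] _ | [//|j] [//|n] _ _].
- have C_gt0 : 0 < 'C(m + n.+1, n.+1) by rewrite bin_gt0 leq_addl.
  have [h Eh odd_h] := binq_half n m.
  have [dvd1 odd1] := @dvdn_odd_quotient (2 * 'C(m + n.+1, n.+1))
    ('C(2 * n.+1, n.+1) * 'C(2 * m + 2 * n.+1, 2 * n.+1)) h _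
    ltac:(lia) ltac:(rewrite binq_bin Eh; ring) odd_h.
  split=> //; case: n {h Eh odd_h dvd1 odd1} C_gt0 => // n C_gt0 _.
  (* The 8 splits as the 4 of [binq_bin_pred] times the 2 of [binq_half], applied at the index one
     lower; hence the criterion on [n - 1]. *)
  have [h Eh odd_h] := binq_half n m.+1.
  rewrite [n.+2 - 1]subn1; apply: (@dvdn_odd_quotient _ _ h); [lia | | exact: odd_h].
  rewrite binq_bin_pred Eh; ring.
- have C_gt0 : 0 < 'C(j.+1 * n.+1, n.+1) by rewrite bin_gt0 leq_pmull.
  have [h Eh odd_h] := binq_half n (j * n.+1).
  (* This odd number divides [binq = 2 * h], hence [h]; the quotient [t] keeps the parity of [h]. *)
  have /dvdnP[t Et] : (2 * (j * n.+1)).+1 %| h.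
    have co : coprime (2 * (j * n.+1)).+1 2 by rewrite coprimen2 /= oddM.
    by rewrite -(Gauss_dvdr _ co) -Eh dvdn_binq.
  apply: (@dvdn_odd_quotient _ _ t); first lia; last first.
    by rewrite -odd_h Et oddM /= oddM andbT.
  (* Multiplying by the Catalan denominator turns [gen_catalan] into a plain binomial, to which
     [binq_bin] applies with [m = j * n.+1]. *)
  apply/eqP; rewrite -(eqn_pmul2r (ltn0Sn (2 * (j * n.+1)))); apply/eqP.
  have := gen_catalanM j (2 * n.+1).
  rewrite (_ : j * (2 * n.+1) = 2 * (j * n.+1)); last by ring.
  rewrite (_ : j.+1 * (2 * n.+1) = 2 * (j * n.+1) + 2 * n.+1); last by ring.
  rewrite [j.+1 - 1]subn1 /= -mulnA => ->.
  rewrite binq_bin Eh Et (_ : j * n.+1 + n.+1 = j.+1 * n.+1); last by ring.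
  ring.
Qed.
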